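(* Let $\mathbb{X}$ be a Cartesian difference category with infinitesimal extension $\varepsilon$ and difference combinator $\boldsymbol\partial$. Let $\mathbb{X}_{\varepsilon\text{-van}}$ be the full subcategory of $\mathbb{X}$ on the $\varepsilon$-vanishing objects, i.e. the objects $A$ such that $\varepsilon(1_A)=0$. Then $\mathbb{X}_{\varepsilon\text{-van}}$ is a Cartesian differential category (with the Cartesian left additive structure of $\mathbb{X}$), where the differential combinator is defined to be the difference combinator, $\mathsf{D}=\boldsymbol\partial$.
   Context: Composition is written $g\circ f$ (first $f$, then $g$). A Cartesian category is a category with chosen finite products: binary products $A\times B$ with projections $\pi_0:A\times B\to A$, $\pi_1:A\times B\to B$, pairing $\langle -,-\rangle$, $f\times g=\langle f\circ\pi_0,g\circ\pi_1\rangle$, and terminal object $\top$ with unique maps $!_A:A\to\top$. A left additive category is a category in which each hom-set is a commutative monoid $(+,0)$ with $(f+g)\circ h=f\circ h+g\circ h$ and $0\circ f=0$. A map $k$ is additive if $k\circ(f+g)=k\circ f+k\circ g$ and $k\circ 0=0$. A Cartesian left additive category is a Cartesian category that is also left additive and whose projections $\pi_0,\pi_1$ are all additive. A Cartesian differential category is a Cartesian left additive category with a differential combinator $\mathsf{D}$, assigning to each $f:A\to B$ a map $\mathsf{D}[f]:A\times A\to B$, such that (for all suitable maps): [CD.1] $\mathsf{D}[f+g]=\mathsf{D}[f]+\mathsf{D}[g]$, $\mathsf{D}[0]=0$; [CD.2] $\mathsf{D}[f]\circ\langle x,y+z\rangle=\mathsf{D}[f]\circ\langle x,y\rangle+\mathsf{D}[f]\circ\langle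 x,z\rangle$, $\mathsf{D}[f]\circ\langle x,0\rangle=0$; [CD.3] $\mathsf{D}[1_A]=\pi_1$, $\mathsf{D}[\pi_0]=\pi_0\circ\pi_1$, $\mathsf{D}[\pi_1]=\pi_1\circ\pi_1$; [CD.4] $\mathsf{D}[\langle f,g\rangle]=\langle\mathsf{D}[f],\mathsf{D}[g]\rangle$, $\mathsf{D}[!_A]=!_{A\times A}$; [CD.5] $\mathsf{D}[g\circ f]=\mathsf{D}[g]\circ\langle f\circ\pi_0,\mathsf{D}[f]\rangle$; [CD.6] $\mathsf{D}[\mathsf{D}[f]]\circ\langle\langle x,y\rangle,\langle 0,z\rangle\rangle=\mathsf{D}[f]\circ\langle x,z\rangle$; [CD.7] $\mathsf{D}[\mathsf{D}[f]]\circ\langle\langle x,y\rangle,\langle z,0\rangle\rangle=\mathsf{D}[\mathsf{D}[f]]\circ\langle\langle x,z\rangle,\langle y,0\rangle\rangle$. An infinitesimal extension $\varepsilon$ on a Cartesian left additive category $\mathbb{X}$ consists of functions $\varepsilon:\mathbb{X}(A,B)\to\mathbb{X}(A,B)$ for all $A,B$ such that [E.1] $\varepsilon(f+g)=\varepsilon(f)+\varepsilon(g)$, $\varepsilon(0)=0$; [E.2] $\varepsilon(g\circ f)=\varepsilon(g)\circ f$; [E.3] $\varepsilon(\pi_i)=\pi_i\circ\varepsilon(1_{A\times B})$ for $i=0,1$. A Cartesian difference category is a Cartesian left additive category with an infinitesimal extension $\varepsilon$ and a difference combinator $\boldsymbol\partial$, assigning to each $f:A\to B$ a map $\boldsymbol\partial[f]:A\times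 A\to B$, such that (for all suitable maps): [C∂.0] $f\circ(x+\varepsilon(y))=f\circ x+\varepsilon(\boldsymbol\partial[f]\circ\langle x,y\rangle)$; [C∂.1] $\boldsymbol\partial[f+g]=\boldsymbol\partial[f]+\boldsymbol\partial[g]$, $\boldsymbol\partial[0]=0$, $\boldsymbol\partial[\varepsilon(f)]=\varepsilon(\boldsymbol\partial[f])$; [C∂.2] $\boldsymbol\partial[f]\circ\langle x,y+z\rangle=\boldsymbol\partial[f]\circ\langle x,y\rangle+\boldsymbol\partial[f]\circ\langle x+\varepsilon(y),z\rangle$, $\boldsymbol\partial[f]\circ\langle x,0\rangle=0$; [C∂.3] $\boldsymbol\partial[1_A]=\pi_1$, $\boldsymbol\partial[\pi_0]=\pi_0\circ\pi_1$, $\boldsymbol\partial[\pi_1]=\pi_1\circ\pi_1$; [C∂.4] $\boldsymbol\partial[\langle f,g\rangle]=\langle\boldsymbol\partial[f],\boldsymbol\partial[g]\rangle$; [C∂.5] $\boldsymbol\partial[g\circ f]=\boldsymbol\partial[g]\circ\langle f\circ\pi_0,\boldsymbol\partial[f]\rangle$; [C∂.6] $\boldsymbol\partial[\boldsymbol\partial[f]]\circ\langle\langle x,y\rangle,\langle 0,z\rangle\rangle=\boldsymbol\partial[f]\circ\langle x+\varepsilon(y),z\rangle$; [C∂.7] $\boldsymbol\partial[\boldsymbol\partial[f]]\circ\langle\langle x,y\rangle,\langle z,0\rangle\rangle=\boldsymbol\partial[\boldsymbol\partial[f]]\circ\langle\langle x,z\rangle,\langle y,0\rangle\rangle$. *)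

(* Defs.v *)
Set Implicit Arguments.
Unset Strict Implicit.
Unset Printing Implicit Defensive.

Declare Scope cat_scope.
Delimit Scope cat_scope with cat.

Reserved Notation "g ∘ f" (at level 40, left associativity).
Reserved Notation "A × B" (at level 40, left associativity).
Reserved Notation "⟨ f , g ⟩" (at level 0, f at level 99, g at level 99,
  format "⟨ f ,  g ⟩").

Record category := Category {
  obj :> Type;
  hom : obj -> obj -> Type;
  idm : forall A, hom A A;
  comp : forall A B C, hom B C -> hom A B -> hom A C;
  comp_idl : forall A B (f : hom A B), comp (idm B) f = f;
  comp_idr : forall A B (f : hom A B), comp f (idm A) = f;
  compA : forall A B C D (h : hom C D) (g : hom B C) (f : hom A B),
    comp h (comp g f) = comp (comp h g) f
}.
Arguments hom {_} _ _.
Arguments idm {_} A.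
Arguments comp {_ _ _ _} g f.

Notation "g ∘ f" := (comp g f) : cat_scope.
Local Open Scope cat_scope.

Class Cartesian (X : category) := {
  prodo : X -> X -> X;
  topo : X;
  pi0 : forall {A B}, hom (prodo A B) A;
  pi1 : forall {A B}, hom (prodo A B) B;
  pair : forall {C A B}, hom C A -> hom C B -> hom C (prodo A B);
  bang : forall A, hom A topo;
  pi0_pair : forall C A B (f : hom C A) (g : hom C B), pi0 ∘ pair f g = f;
  pi1_pair : forall C A B (f : hom C A) (g : hom C B), pi1 ∘ pair f g = g;
  pair_unique : forall C A B (f : hom C A) (g : hom C B)
    (h : hom C (prodo A B)), pi0 ∘ h = f -> pi1 ∘ h = g -> h = pair f g;
  bang_unique : forall A (h : hom A topo), h = bang A
}.

Notation "A × B" := (prodo A B) : cat_scope.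
Notation "⟨ f , g ⟩" := (pair f g) : cat_scope.

(* Precomposition preserves + and 0; postcomposition is not required to. *)
Class LeftAdditive (X : category) := {
  add : forall {A B : X}, hom A B -> hom A B -> hom A B;
  zero : forall {A B : X}, hom A B;
  addA : forall (A B : X) (f g h : hom A B), add f (add g h) = add (add f g) h;
  addC : forall (A B : X) (f g : hom A B), add f g = add g f;
  add0l : forall (A B : X) (f : hom A B), add zero f = f;
  comp_addl : forall (A B C : X) (f g : hom B C) (h : hom A B),
    add f g ∘ h = add (f ∘ h) (g ∘ h);
  comp_0l : forall (A B C : X) (f : hom A B),
    (zero : hom B C) ∘ f = zero
}.

Notation "f + g" := (add f g) : cat_scope.
Notation "0" := zero : cat_scope.

Definition additive (X : category) (L : LeftAdditive X) (A B : X)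
    (k : hom A B) : Prop :=
  (forall (C : X) (f g : hom C A), k ∘ (f + g) = k ∘ f + k ∘ g) /\
  (forall C : X, k ∘ (0 : hom C A) = 0).

Record cartesian_left_additive_category := CartesianLeftAdditive {
  cla_cat :> category;
  cla_cartesian :: Cartesian cla_cat;
  cla_left_additive :: LeftAdditive cla_cat;
  pi0_additive : forall A B : cla_cat, additive _ (pi0 : hom (A × B) A);
  pi1_additive : forall A B : cla_cat, additive _ (pi1 : hom (A × B) B)
}.

Record is_cartesian_differential (X : cartesian_left_additive_category)
    (D : forall A B : X, hom A B -> hom (A × A) B) : Prop := {
  CD1_add : forall (A B : X) (f g : hom A B), D _ _ (f + g) = D _ _ f + D _ _ g;
  CD1_zero : forall A B : X, D A B 0 = 0;
  CD2_add : forall (A B C : X) (f : hom A B) (x y z : hom C A),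
    D _ _ f ∘ ⟨x, y + z⟩ = D _ _ f ∘ ⟨x, y⟩ + D _ _ f ∘ ⟨x, z⟩;
  CD2_zero : forall (A B C : X) (f : hom A B) (x : hom C A),
    D _ _ f ∘ ⟨x, 0⟩ = 0;
  CD3_id : forall A : X, D A A (idm A) = pi1;
  CD3_pi0 : forall A B : X, D (A × B) A pi0 = pi0 ∘ pi1;
  CD3_pi1 : forall A B : X, D (A × B) B pi1 = pi1 ∘ pi1;
  CD4_pair : forall (A B C : X) (f : hom A B) (g : hom A C),
    D _ _ ⟨f, g⟩ = ⟨D _ _ f, D _ _ g⟩;
  CD4_bang : forall A : X, D _ _ (bang A) = bang (A × A);
  CD5 : forall (A B C : X) (g : hom B C) (f : hom A B),
    D _ _ (g ∘ f) = D _ _ g ∘ ⟨f ∘ pi0, D _ _ f⟩;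
  CD6 : forall (A B C : X) (f : hom A B) (x y z : hom C A),
    D _ _ (D _ _ f) ∘ ⟨⟨x, y⟩, ⟨0, z⟩⟩ = D _ _ f ∘ ⟨x, z⟩;
  CD7 : forall (A B C : X) (f : hom A B) (x y z : hom C A),
    D _ _ (D _ _ f) ∘ ⟨⟨x, y⟩, ⟨z, 0⟩⟩ = D _ _ (D _ _ f) ∘ ⟨⟨x, z⟩, ⟨y, 0⟩⟩
}.

Record is_infinitesimal_extension (X : cartesian_left_additive_category)
    (e : forall A B : X, hom A B -> hom A B) : Prop := {
  E1_add : forall (A B : X) (f g : hom A B), e _ _ (f + g) = e _ _ f + e _ _ g;
  E1_zero : forall A B : X, e A B 0 = 0;
  E2 : forall (A B C : X) (g : hom B C) (f : hom A B),
    e _ _ (g ∘ f) = e _ _ g ∘ f;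
  E3_pi0 : forall A B : X, e (A × B) A pi0 = pi0 ∘ e _ _ (idm (A × B));
  E3_pi1 : forall A B : X, e (A × B) B pi1 = pi1 ∘ e _ _ (idm (A × B))
}.

Record is_difference_combinator (X : cartesian_left_additive_category)
    (e : forall A B : X, hom A B -> hom A B)
    (d : forall A B : X, hom A B -> hom (A × A) B) : Prop := {
  Cd0 : forall (A B C : X) (f : hom A B) (x y : hom C A),
    f ∘ (x + e _ _ y) = f ∘ x + e _ _ (d _ _ f ∘ ⟨x, y⟩);
  Cd1_add : forall (A B : X) (f g : hom A B), d _ _ (f + g) = d _ _ f + d _ _ g;
  Cd1_zero : forall A B : X, d A B 0 = 0;
  Cd1_eps : forall (A B : X) (f : hom A B), d _ _ (e _ _ f) = e _ _ (d _ _ f);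
  Cd2_add : forall (A B C : X) (f : hom A B) (x y z : hom C A),
    d _ _ f ∘ ⟨x, y + z⟩ = d _ _ f ∘ ⟨x, y⟩ + d _ _ f ∘ ⟨x + e _ _ y, z⟩;
  Cd2_zero : forall (A B C : X) (f : hom A B) (x : hom C A),
    d _ _ f ∘ ⟨x, 0⟩ = 0;
  Cd3_id : forall A : X, d A A (idm A) = pi1;
  Cd3_pi0 : forall A B : X, d (A × B) A pi0 = pi0 ∘ pi1;
  Cd3_pi1 : forall A B : X, d (A × B) B pi1 = pi1 ∘ pi1;
  Cd4 : forall (A B C : X) (f : hom A B) (g : hom A C),
    d _ _ ⟨f, g⟩ = ⟨d _ _ f, d _ _ g⟩;
  Cd5 : forall (A B C : X) (g : hom B C) (f : hom A B),
    d _ _ (g ∘ f) = d _ _ g ∘ ⟨f ∘ pi0, d _ _ f⟩;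
  Cd6 : forall (A B C : X) (f : hom A B) (x y z : hom C A),
    d _ _ (d _ _ f) ∘ ⟨⟨x, y⟩, ⟨0, z⟩⟩ = d _ _ f ∘ ⟨x + e _ _ y, z⟩;
  Cd7 : forall (A B C : X) (f : hom A B) (x y z : hom C A),
    d _ _ (d _ _ f) ∘ ⟨⟨x, y⟩, ⟨z, 0⟩⟩ = d _ _ (d _ _ f) ∘ ⟨⟨x, z⟩, ⟨y, 0⟩⟩
}.

Record cartesian_difference_category := CartesianDifference {
  cdc_cla :> cartesian_left_additive_category;
  eps : forall A B : cdc_cla, hom A B -> hom A B;
  eps_axioms : is_infinitesimal_extension eps;
  diff : forall A B : cdc_cla, hom A B -> hom (A × A) B;
  diff_axioms : is_difference_combinator eps diff
}.
Arguments eps {_ A B} f.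
Arguments diff {_ A B} f.

(* An object is paired with a proof of P, but hom-types ignore that proof. *)
Definition full_subcategory (X : category) (P : X -> Prop) : category := {|
  obj := {A : X | P A};
  hom := fun A B => hom (proj1_sig A) (proj1_sig B);
  idm := fun A => idm (proj1_sig A);
  comp := fun _ _ _ g f => g ∘ f;
  comp_idl := fun _ _ f => comp_idl f;
  comp_idr := fun _ _ f => comp_idr f;
  compA := fun _ _ _ _ h g f => compA h g f
|}.

(* Condition under which the chosen products of X restrict to the full
   subcategory on P, so that they can be reused there unchanged. *)
Record product_closed (X : category) (c : Cartesian X) (P : X -> Prop) : Prop := {
  closed_prodo : forall A B, P A -> P B -> P (A × B);
  closed_topo : P topo
}.

Definition full_cartesian (X : category) (c : Cartesian X) (P : X -> Prop)
    (h : product_closed c P) : Cartesian (full_subcategory P) :=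
  Build_Cartesian (X := full_subcategory P)
    (prodo := fun A B => exist P (proj1_sig A × proj1_sig B)
                (closed_prodo h (proj2_sig A) (proj2_sig B)))
    (topo := exist P topo (closed_topo h))
    (pi0 := fun _ _ => pi0 (X := X))
    (pi1 := fun _ _ => pi1 (X := X))
    (pair := fun _ _ _ f g => pair (X := X) f g)
    (bang := fun A => bang (proj1_sig A))
    (fun _ _ _ f g => pi0_pair (X := X) f g)
    (fun _ _ _ f g => pi1_pair (X := X) f g)
    (fun _ _ _ _ _ _ h0 h1 => pair_unique (X := X) h0 h1)
    (fun _ k => bang_unique (X := X) k).

Definition full_left_additive (X : category) (L : LeftAdditive X)
    (P : X -> Prop) : LeftAdditive (full_subcategory P) :=
  Build_LeftAdditive (X := full_subcategory P)
    (add := fun _ _ f g => add (X := X) f g)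
    (zero := fun _ _ => zero (X := X))
    (fun _ _ f g h => addA (X := X) f g h)
    (fun _ _ f g => addC (X := X) f g)
    (fun _ _ f => add0l (X := X) f)
    (fun _ _ _ f g h => comp_addl (X := X) f g h)
    (fun _ _ _ f => comp_0l (X := X) _ f).

Definition full_cartesian_left_additive (X : cartesian_left_additive_category)
    (P : X -> Prop) (h : product_closed (cla_cartesian X) P) :
    cartesian_left_additive_category :=
  CartesianLeftAdditive
    (cla_cat := full_subcategory P)
    (cla_cartesian := full_cartesian h)
    (cla_left_additive := full_left_additive _ P)
    (fun A B => conj
      (fun C f g => proj1 (pi0_additive (proj1_sig A) (proj1_sig B)) _ f g)
      (fun C => proj2 (pi0_additive (proj1_sig A) (proj1_sig B)) (proj1_sig C)))
    (fun A B => conj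
      (fun C f g => proj1 (pi1_additive (proj1_sig A) (proj1_sig B)) _ f g)
      (fun C => proj2 (pi1_additive (proj1_sig A) (proj1_sig B)) (proj1_sig C))).

Definition eps_vanishing (X : cartesian_difference_category) (A : X) : Prop :=
  eps (idm A) = 0.

(* Main.v *)
(** Since [ε(f) = ε(1_B ∘ f) = ε(1_B) ∘ f], every map into an ε-vanishing object
    is killed by ε, so the terms [x + ε(y)] distinguishing the difference axioms
    2 and 6 from the differential ones collapse to [x].  Products of ε-vanishing
    objects are ε-vanishing because [π_i ∘ ε(1) = ε(π_i)]. *)

Require Import Defs.

Local Open Scope cat_scope.

Lemma add0r (X : category) (L : LeftAdditive X) (A B : X) (f : hom A B) :
  f + 0 = f.
Proof. rewrite addC; apply add0l. Qed.

Lemma pair_ext (X : category) (c : Cartesian X) (A B C : X)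
    (h k : hom C (A × B)) : pi0 ∘ h = pi0 ∘ k -> pi1 ∘ h = pi1 ∘ k -> h = k.
Proof.
  intros E0 E1.
  rewrite (pair_unique E0 E1); symmetry.
  now apply pair_unique.
Qed.

Lemma eps_into_vanishing (X : cartesian_difference_category) (A B : X)
    (f : hom A B) : eps_vanishing B -> eps f = 0.
Proof.
  intros HB.
  rewrite <- (comp_idl f), (E2 (eps_axioms X)), HB.
  apply comp_0l.
Qed.

Lemma eps_vanishing_product_closed (X : cartesian_difference_category) :
  product_closed (cla_cartesian X) (@eps_vanishing X).
Proof.
  split.
  - intros A B HA HB; apply pair_ext.
    + rewrite <- (E3_pi0 (eps_axioms X)), (proj2 (pi0_additive A B)).
      now apply eps_into_vanishing.
    + rewrite <- (E3_pi1 (eps_axioms X)), (proj2 (pi1_additive A B)).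
      now apply eps_into_vanishing.
  (* Both sides are maps into the terminal object. *)
  - now unfold eps_vanishing; rewrite (bang_unique (eps _)), (bang_unique 0).
Qed.

(** The Cartesian structure on the subcategory is built from a proof of product closure, hence the
    existential. *)
Theorem proposition4p13 (X : cartesian_difference_category) :
  exists h : product_closed (cla_cartesian X) (@eps_vanishing X),
    is_cartesian_differential (X := full_cartesian_left_additive h)
      (fun A B f => diff (A := proj1_sig A) (B := proj1_sig B) f).
Proof.
  exists (eps_vanishing_product_closed X).
  pose proof (diff_axioms X) as HD.
  split; simpl.
  - intros; apply (Cd1_add HD).
  - intros; apply (Cd1_zero HD).
  - intros [A HA] B C f x y z; simpl in *.
    (* [y] lands in [A], the domain of [f], so vanishing of [A] reduces [x + eps y] to [x]. *)
    rewrite (Cd2_add HD), (eps_into_vanishing _ _ _ y HA).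
    now rewrite add0r.
  - intros; apply (Cd2_zero HD).
  - intros; apply (Cd3_id HD).
  - intros; apply (Cd3_pi0 HD).
  - intros; apply (Cd3_pi1 HD).
  - intros; apply (Cd4 HD).
  (* No difference axiom covers [bang]; terminality of [topo] does. *)
  - intros A; apply (bang_unique (X := X)).
  - intros; apply (Cd5 HD).
  - intros [A HA] B C f x y z; simpl in *.
    rewrite (Cd6 HD), (eps_into_vanishing _ _ _ y HA).
    now rewrite add0r.
  - intros; apply (Cd7 HD).
Qed.
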